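(* Let $a,b,c\in\mathbb{R}$ and $\alpha>-1$. Then the following conditions are equivalent. (i) The operator $S_{a,b,c}$ is bounded from $L^1_\alpha$ to $L^\infty$. (ii) The operator $T_{a,b,c}$ is bounded from $L^1_\alpha$ to $L^\infty$. (iii) The parameters satisfy $$a\ge 0,\qquad \alpha\le b,\qquad c\le a+b-\alpha.$$
   Context: Let $n\ge 1$ be an integer, $\mathbb{B}_n$ the open unit ball of $\mathbb{C}^n$, $\langle z,w\rangle=\sum_{j=1}^n z_j\overline{w_j}$, and $dv$ the normalized volume measure on $\mathbb{B}_n$, so $v(\mathbb{B}_n)=1$. For $\alpha>-1$ let $dv_\alpha(z)=c_\alpha(1-|z|^2)^\alpha\,dv(z)$ with $c_\alpha=\Gamma(n+\alpha+1)/[n!\,\Gamma(\alpha+1)]$, so that $v_\alpha(\mathbb{B}_n)=1$. $L^1_\alpha=L^1(\mathbb{B}_n,dv_\alpha)$ with norm $\|f\|_{1,\alpha}=\int_{\mathbb{B}_n}|f|\,dv_\alpha$; $L^\infty$ is the space of essentially bounded measurable functions on $\mathbb{B}_n$ with the essential supremum norm. For $a,b,c\in\mathbb{R}$ the Forelli-Rudin type operators are $$T_{a,b,c}f(z)=(1-|z|^2)^a\int_{\mathbb{B}_n}\frac{(1-|w|^2)^b}{(1-\langle z,w\rangle)^c}f(w)\,dv(w),\qquad S_{a,b,c}f(z)=(1-|z|^2)^a\int_{\mathbb{B}_n}\frac{(1-|w|^2)^b}{|1-\langle z,w\rangle|^c}f(w)\,dv(w),$$ where the power is the principal branch ($\operatorname{Re}(1-\langle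 z,w\rangle)>0$). Such an operator is bounded from $L^1_\alpha$ to $L^\infty$ if for every $f\in L^1_\alpha$ the defining integral converges (absolutely, for $z\in\mathbb{B}_n$) and there is a constant $C$, independent of $f$, with the $L^\infty$ norm of the image at most $C\|f\|_{1,\alpha}$. *)

(* Defs.v *)
From HB Require Import structures.
From mathcomp Require Import all_boot all_order all_algebra.
From mathcomp Require Import complex.
From mathcomp Require Import all_classical all_reals all_analysis.
From mathcomp Require Import measurable_realfun ess_sup_inf.

Set Implicit Arguments.
Unset Strict Implicit.
Unset Printing Implicit Defensive.

Import Order.TTheory GRing.Theory Num.Theory.
Import numFieldNormedType.Exports.

Local Open Scope classical_set_scope.
Local Open Scope ring_scope.
Local Open Scope complex_scope.

(* Borel structure on C: the sigma-algebra pulled back from R * R. *)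
Section complex_measurable.
Variable R : realType.

Definition complex_pair (z : R[i]) : measurableTypeR R * measurableTypeR R :=
  (complex.Re z, complex.Im z).

Definition pair_complex (p : measurableTypeR R * measurableTypeR R) : R[i] :=
  (p.1 : R) +i* (p.2 : R).

HB.instance Definition _ := isPointed.Build R[i] 0.

HB.instance Definition _ := Measurable.copy R[i]
  (g_sigma_algebra_preimageType complex_pair).

Lemma pair_complexK : cancel pair_complex complex_pair.
Proof. by case. Qed.

Lemma measurable_complex_pair : measurable_fun [set: R[i]] complex_pair.
Proof. by move=> _ A mA; exists A. Qed.

Lemma measurable_pair_complex : measurable_fun setT pair_complex.
Proof.
move=> _ _ [B mB <-]; rewrite !setTI.
suff -> : pair_complex @^-1` (complex_pair @^-1` B) = B by [].
by apply/seteqP; split=> -[x y].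
Qed.


Lemma measurable_Re : measurable_fun [set: R[i]] (@complex.Re R).
Proof. exact: (measurableT_comp measurable_fst measurable_complex_pair). Qed.

Lemma measurable_Im : measurable_fun [set: R[i]] (@complex.Im R).
Proof. exact: (measurableT_comp measurable_snd measurable_complex_pair). Qed.

Lemma measurable_sqrt : measurable_fun [set: R] (@Num.sqrt R).
Proof. by apply: continuous_measurable_fun; exact: sqrt_continuous. Qed.

Lemma measurable_normc : measurable_fun [set: R[i]] (@Normc.normc R).
Proof.
rewrite (_ : @Normc.normc R =
    (fun z => Num.sqrt (complex.Re z ^+ 2 + complex.Im z ^+ 2))).
  apply: (measurableT_comp measurable_sqrt); apply: measurable_funD.
    by apply: measurable_funX; exact: measurable_Re.
  by apply: measurable_funX; exact: measurable_Im.
by apply/funext => -[].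
Qed.
End complex_measurable.

(* Image of a product of two sigma-finite measures under an embedding f with
   measurable left inverse g. *)
Section product_image.
Local Open Scope ereal_scope.
Context d1 d2 d3 (T1 : measurableType d1) (T2 : measurableType d2)
  (T3 : measurableType d3) (R : realType).
Variables (m1 : {sigma_finite_measure set T1 -> \bar R}).
Variables (m2 : {sigma_finite_measure set T2 -> \bar R}).
Variables (f : T1 * T2 -> T3) (g : T3 -> T1 * T2).
Hypotheses (fK : cancel f g) (mf : measurable_fun [set: T1 * T2] f).
Hypothesis mg : measurable_fun [set: T3] g.

Definition product_image of cancel f g & measurable_fun setT f &
  measurable_fun setT g : set T3 -> \bar R := pushforward (m1 \x m2) f.

Local Notation pim := (product_image fK mf mg).

HB.instance Definition _ := Measure.copy pim
  (measure_function_pushforward__canonical__measure_function_Measure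
    (m1 \x m2) mf).

Let pim_sigma_finite : sigma_finite setT pim.
Proof.
have /sigma_finiteP[F [TF ndF Foo]] := sigma_finiteT m1.
have /sigma_finiteP[G [TG ndG Goo]] := sigma_finiteT m2.
exists (fun k => g @^-1` (F k `*` G k)).
  rewrite -preimage_bigcup -[LHS](preimage_setT g); congr (_ @^-1` _).
  rewrite -setXTT TF TG predeqE => -[x y]; split.
    move=> [/= [n _ Fnx] [k _ Gky]]; exists (maxn n k) => //; split.
    - by move: x Fnx; exact/subsetPset/ndF/leq_maxl.
    - by move: y Gky; exact/subsetPset/ndG/leq_maxr.
  by move=> [n _ []/= ? ?]; split; exists n.
move=> k; have [mF Fk] := Foo k; have [mG Gk] := Goo k; split.
  by rewrite -[X in measurable X]setTI; apply: mg => //; exact: measurableX.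
rewrite /product_image /pushforward -comp_preimage.
rewrite (_ : g \o f = idfun) ?preimage_id; last exact/funext.
by rewrite product_measure1E// lte_mul_pinfty// ge0_fin_numE.
Qed.

HB.instance Definition _ := Measure_isSigmaFinite.Build _ _ _ pim
  pim_sigma_finite.
End product_image.

Definition lebesgueC (R : realType) : set R[i] -> \bar R :=
  product_image (@lebesgue_measure R) (@lebesgue_measure R)
    (@pair_complexK R) (@measurable_pair_complex R) (@measurable_complex_pair R).

HB.instance Definition _ (R : realType) :=
  SigmaFiniteMeasure.on (@lebesgueC R).

(* Product measure mu^n on n.-tuple T, by mu^0 = dirac, mu^(n+1) = mu x mu^n. *)
Section tuple_measure.
Local Open Scope ereal_scope.
Context d (T : measurableType d) (R : realType).
Variable mu : {sigma_finite_measure set T -> \bar R}.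

Definition tuple_cons n (p : T * n.-tuple T) : n.+1.-tuple T :=
  [tuple of p.1 :: p.2].

Definition tuple_uncons n (t : n.+1.-tuple T) : T * n.-tuple T :=
  (thead t, [tuple of behead t]).

Lemma tuple_consK n : cancel (@tuple_cons n) (@tuple_uncons n).
Proof.
by move=> [x t]; rewrite /tuple_uncons /=; congr pair; apply/val_inj.
Qed.

Lemma measurable_tuple_cons n : measurable_fun setT (@tuple_cons n).
Proof. exact: measurable_cons. Qed.

Lemma measurable_tuple_uncons n : measurable_fun setT (@tuple_uncons n).
Proof.
apply: measurable_fun_pair; last exact: measurable_behead.
exact: measurable_tnth.
Qed.

Fixpoint tuple_measure n : {sigma_finite_measure set (n.-tuple T) -> \bar R} :=
  match n with
  | 0%N => [the {sigma_finite_measure set (0.-tuple T) -> \bar R} of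
             \d_([tuple] : 0.-tuple T)]
  | k.+1 => [the {sigma_finite_measure set (k.+1.-tuple T) -> \bar R} of
             product_image mu (tuple_measure k) (@tuple_consK k)
               (@measurable_tuple_cons k) (@measurable_tuple_uncons k)]
  end.

Lemma tuple_measure_box n (A : 'I_n -> set T) :
  (forall i, measurable (A i)) ->
  tuple_measure n [set t | forall i, A i (tnth t i)] = \prod_(i < n) mu (A i).
Proof.
elim: n A => [A _|n IHn A mA].
  by rewrite big_ord0 /= diracE mem_set// => -[].
rewrite big_ord_recl -IHn; last by move=> i; exact: mA.
rewrite /= /product_image /pushforward.
rewrite -product_measure1E//; last first.
  have -> : [set t : n.-tuple T | forall i, A (lift ord0 i) (tnth t i)] =
      \bigcap_(i in [set: 'I_n]) ((@tnth _ T ^~ i) @^-1` A (lift ord0 i)).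
    by apply/seteqP; split=> t /= At i; [move=> _; exact: At|exact: (At i I)].
  apply: fin_bigcap_measurable => // i _.
  by rewrite -[X in measurable X]setTI; apply: (measurable_tnth i);
    [exact: measurableT|exact: mA].
congr (_ _); apply/seteqP; split=> -[x t] /=.
  move=> At; split=> [|i]; first exact: (At ord0).
  by have := At (lift ord0 i); rewrite tnthS.
move=> [Ax At] i; have [j ->|->//] := unliftP ord0 i.
by rewrite tnthS; exact: At.
Qed.
End tuple_measure.

(* Points of C^n are n-tuples of complex numbers. *)
Section ball.
Variables (R : realType) (n : nat).
Implicit Types z w : n.-tuple R[i].

Definition hdot z w : R[i] := \sum_(j < n) tnth z j * (tnth w j)^*.

Definition hnorm z : R := Num.sqrt (\sum_(j < n) Normc.normc (tnth z j) ^+ 2).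

Definition cball : set (n.-tuple R[i]) := [set z | hnorm z < 1].

Lemma measurable_hnorm : measurable_fun setT hnorm.
Proof.
apply: (measurableT_comp (@measurable_sqrt R)).
apply: measurable_sum => j; apply: measurable_funX.
exact: (measurableT_comp (@measurable_normc R) (measurable_tnth j)).
Qed.

Lemma measurable_cball : measurable cball.
Proof.
rewrite (_ : cball = hnorm @^-1` `]-oo, 1[).
  by rewrite -[X in measurable X]setTI; exact: measurable_hnorm.
by apply/seteqP; split=> z /=; rewrite in_itv.
Qed.

Definition vol : set (n.-tuple R[i]) -> \bar R :=
  tuple_measure (@lebesgueC R) n.

HB.instance Definition _ := SigmaFiniteMeasure.on vol.

Let vol_inv_ge0 : 0 <= (fine (vol cball))^-1.
Proof. by rewrite invr_ge0 fine_ge0. Qed.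

Definition nvol : set (n.-tuple R[i]) -> \bar R :=
  mscale (NngNum vol_inv_ge0) (mrestr vol measurable_cball).

HB.instance Definition _ := Measure.on nvol.

End ball.

Section forelli_rudin.
Variables (R : realType) (n : nat).
Implicit Types (a b c s alpha : R) (u : R[i]) (z w : n.-tuple R[i]).
Implicit Types (D : set (n.-tuple R[i])) (f : n.-tuple R[i] -> R[i]).
Implicit Types k : n.-tuple R[i] -> n.-tuple R[i] -> R[i].

Definition Gamma s : R :=
  \int[@lebesgue_measure R]_(t in `]0, +oo[) (t `^ (s - 1) * expR (- t)).

Definition c_alpha alpha : R :=
  Gamma (n%:R + alpha + 1) / (n`!%:R * Gamma (alpha + 1)).

(* The measure dv_alpha appears through its density
   c_alpha (1 - |z|^2)^alpha with respect to nvol. *)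
Definition L1norm alpha f : \bar R :=
  \int[@nvol R n]_(z in @cball R n)
    (Normc.normc (f z) * (c_alpha alpha * (1 - hnorm z ^+ 2) `^ alpha))%:E.

Definition in_L1 alpha f :=
  measurable_fun (@cball R n) f /\ (L1norm alpha f < +oo)%E.

(* nvol gives no mass to the complement of the ball, so this is the essential
   supremum over the ball. *)
Definition Linfnorm f : \bar R :=
  ess_sup (@nvol R n) (fun z => (Normc.normc (f z))%:E).

Definition in_Linf f :=
  measurable_fun (@cball R n) f /\ (Linfnorm f < +oo)%E.

Definition abs_convergent D f :=
  measurable_fun D f /\
  (\int[@nvol R n]_(w in D) (Normc.normc (f w))%:E < +oo)%E.

Definition cintegral D f : R[i] :=
  (\int[@nvol R n]_(w in D) complex.Re (f w)) +i*
  (\int[@nvol R n]_(w in D) complex.Im (f w)).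

(* Principal branch of u^c, meaningful for 0 < Re u only: there the principal
   argument of u is atan (Im u / Re u). *)
Definition cpow u c : R[i] :=
  let theta := atan (complex.Im u / complex.Re u) in
  (Normc.normc u `^ c)%:C * (cos (c * theta) +i* sin (c * theta)).

Definition T_kernel b c z w : R[i] :=
  ((1 - hnorm w ^+ 2) `^ b)%:C / cpow (1 - hdot z w) c.

Definition S_kernel b c z w : R[i] :=
  ((1 - hnorm w ^+ 2) `^ b / Normc.normc (1 - hdot z w) `^ c)%:C.

(* T_(a,b,c) and S_(a,b,c) are fr_op a (T_kernel b c) and
   fr_op a (S_kernel b c). *)
Definition fr_op a k f z : R[i] :=
  ((1 - hnorm z ^+ 2) `^ a)%:C *
  cintegral (@cball R n) (fun w => k z w * f w).

Definition bounded_L1_Linf alpha a k : Prop :=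
  (forall f, in_L1 alpha f -> forall z, cball z ->
     abs_convergent (@cball R n) (fun w => k z w * f w)) /\
  exists C : R, forall f, in_L1 alpha f ->
    in_Linf (fr_op a k f) /\
    (Linfnorm (fr_op a k f) <= C%:E * L1norm alpha f)%E.

End forelli_rudin.

Arguments T_kernel {R} n b c z w.
Arguments S_kernel {R} n b c z w.

(* Main.v *)
Require Import Defs.
From HB Require Import structures.
From mathcomp Require Import all_boot all_order all_algebra.
From mathcomp Require Import complex.
From mathcomp Require Import all_classical all_reals all_analysis.
From mathcomp Require Import measurable_realfun ess_sup_inf ring lra.

(* An integral operator with continuous kernel K(z,w) maps L^1_alpha boundedly
   to L^oo iff |K(z,w)| <= M (1-|w|^2)^alpha for all z, w: sufficiency is
   immediate, and necessity follows by testing on normalized indicators of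
   small boxes around w. As |1-<z,w>|^c has modulus independent of the phase,
   S and T satisfy the same pointwise condition
     (1-|z|^2)^a (1-|w|^2)^(b-alpha) <= M |1-<z,w>|^c.
   It follows from the three inequalities on a, b, c because
   1-|z|^2, 1-|w|^2 <= 2 |1-<z,w>| <= 6, and it implies them by letting
   t = 1-r^2 tend to 0 at the pairs (r e_1, 0), (0, r e_1), (r e_1, r e_1),
   where it bounds t^a, t^(b-alpha), t^(a+b-alpha-c) respectively. *)

Set Implicit Arguments.
Unset Strict Implicit.
Unset Printing Implicit Defensive.

Import Order.TTheory GRing.Theory Num.Theory.
Import numFieldNormedType.Exports.

Local Open Scope classical_set_scope.
Local Open Scope ring_scope.

(** * Positivity of the Gamma function *)

Lemma continuous_powR_gt0 (R : realType) (p x : R) : 0 < x ->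
  {for x, continuous (@powR R ^~ p)}.
Proof.
move=> x0; apply: differentiable_continuous; apply/derivable1_diffP.
by apply: derivable_powR; rewrite in_itv/= x0.
Qed.

Section Gamma.
Variable R : realType.
Implicit Types s t p : R.

(* The Gamma integrand is dominated by a multiple of the derivative [dF s] of the
   bounded increasing function [F s], which settles both endpoints at once. *)
Let F s t : R := (t / (1 + t)) `^ s.
Let dF s t : R := s * (t / (1 + t)) `^ (s - 1) * (1 + t) ^- 2.

Let is_derive_F s t : 0 < t -> is_derive t 1 (F s) (dF s t).
Proof.
move=> t0; have t1 : 1 + t != 0 by apply: lt0r_neq0; lra.
have ft0 : 0 < t / (1 + t) by rewrite divr_gt0//; lra.
have H : is_derive t 1 (fun x : R => x / (1 + x)) ((1 + t) ^- 2).
  apply: is_derive_eq => /=.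
  by rewrite /GRing.scale/=; field.
have := @is_derive1_comp R (@powR R ^~ s) (fun x => x / (1 + x)) t _ _
  (is_derive1_powR s ft0) H.
by move=> /is_derive_eq; apply; rewrite /dF mulrC.
Qed.

Let dF_ge0 s t : 0 < s -> 0 <= t -> 0 <= dF s t.
Proof.
by move=> s0 t0; rewrite /dF !mulr_ge0 ?powR_ge0 ?invr_ge0 ?exprn_ge0//; lra.
Qed.

Let F_cvgy s : F s t @[t --> +oo] --> (1:R).
Proof.
have H : (t / (1 + t)) @[t --> +oo] --> (1:R).
  have : 1 - (1 + t)^-1 @[t --> +oo] --> (1 - 0 : R).
    apply: cvgB; first exact: cvg_cst.
    apply/gtr0_cvgV0.
      near=> t; apply: (@lt_trans _ _ t); last by rewrite ltrDr.
      by near: t; apply: nbhs_pinfty_gt.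
    exact: cvg_addrl.
  rewrite subr0; apply: cvg_trans; apply: near_eq_cvg; near=> t.
  have : 0 < t by near: t; apply: nbhs_pinfty_gt.
  by move=> t0; field; apply: lt0r_neq0; lra.
suff : F s t @[t --> +oo] --> ((1 : R) `^ s : R) by rewrite powR1.
apply: (cvg_comp (fun t => t / (1 + t)) (@powR R ^~ s) H).
exact: continuous_powR_gt0.
Unshelve. all: by end_near. Qed.

Let continuous_dF s x : 0 < x -> {for x, continuous (dF s)}.
Proof.
move=> x0; have x1 : 1 + x != 0 by rewrite lt0r_neq0//; lra.
have c1 : (1 + t @[t --> x]) --> 1 + x by apply: cvgD; [exact: cvg_cst|exact: cvg_id].
apply: cvgM; last first.
  by apply: cvgV; [rewrite expf_neq0|exact: (cvgM c1 c1)].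
apply: cvgM; first exact: cvg_cst.
apply: (cvg_comp (fun t => t / (1 + t)) (@powR R ^~ (s - 1))).
  exact: (cvgM cvg_id (cvgV x1 c1)).
by apply: continuous_powR_gt0; rewrite divr_gt0//; lra.
Qed.

(** The fundamental theorem of calculus gives [1 - F s a], so the bound 1 is uniform in [a].
    Starting at [a > 0] avoids the endpoint 0, where [dF s] is singular for [s < 1]. *)
Let integral_dF s (a : R) : 0 < s -> 0 < a ->
  (\int[@lebesgue_measure R]_(t in `[a, +oo[) (dF s t)%:E <= 1)%E.
Proof.
move=> s0 a0.
rewrite (@ge0_continuous_FTC2y _ _ (F s) a 1).
- by rewrite leeBlDr// leeDl// lee_fin powR_ge0.
- by move=> x ax; apply: dF_ge0 => //; lra.
- apply/continuous_within_itvcyP; split.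
    by move=> x; rewrite in_itv/= andbT => ax; apply: continuous_dF; lra.
  by apply: cvg_at_right_filter; exact: continuous_dF.
- exact: F_cvgy.
- by move=> x ax; have [] := @is_derive_F s x (lt_trans a0 ax).
- apply: cvg_at_right_filter; apply: differentiable_continuous; apply/derivable1_diffP.
  by have [] := is_derive_F s a0.
- move=> x; rewrite in_itv/= andbT => ax; rewrite derive1E.
  by have [] := @is_derive_F s x (lt_trans a0 ax).
Qed.

(** The quotient of the integrand by [dF s t] is $s^{-1}(1+t)^{s+1}e^{-t}$, which is bounded on the
    half-line. *)
Let integrand_le s : 0 < s -> exists2 K : R, 0 <= K & forall t, 0 < t ->
   t `^ (s - 1) * expR (- t) <= K * dF s t.
Proof.
(* [K] is the maximum of $u^p e^{1-u}$ over $u = 1+t$, attained at $u = p$. *)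
move=> s0; pose p := s + 1; pose K := expR (1 + p * ln p - p).
exists (K / s); first by rewrite divr_ge0 ?expR_ge0// ltW.
move=> t t0; have t1 : 0 < 1 + t by lra.
have p0 : 0 < p by rewrite /p; lra.
have -> : K / s * dF s t = t `^ (s - 1) * (K * (1 + t) `^ (- p)).
  rewrite /dF powRM ?invr_ge0 ?ltW// -(@powR_inv1 _ (1 + t)) ?ltW// -powRrM.
  rewrite -(powR_invn 2) ?ltW//.
  rewrite (_ : - p = -1 * (s - 1) - 2); last by rewrite /p; ring.
  rewrite (@powRD _ _ (-1 * (s - 1)) (- 2)); last by rewrite (gt_eqF t1)/= implybT.
  by field; rewrite gt_eqF.
rewrite ler_pM2l ?powR_gt0//.
rewrite /powR gt_eqF// -expRD ler_expR.
(* The inequality $\ln x \le x - 1$ at $x = (1+t)/p$ is the tangent bound for the logarithm at the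
   maximum point. *)
have : ln ((1 + t) / p) <= (1 + t) / p - 1.
  have := @le_ln1Dx R ((1 + t) / p - 1); rewrite addrCA subrr addr0; apply.
  by rewrite ltrBrDl subrr divr_gt0.
rewrite ln_div ?posrE// -(ler_pM2l p0).
have -> : p * ((1 + t) / p - 1) = 1 + t - p by field; rewrite gt_eqF.
lra.
Qed.

Lemma measurable_Gamma_integrand s :
  measurable_fun [set: R] (fun t => (t `^ (s - 1) * expR (- t))%:E).
Proof.
apply/measurable_EFinP; apply: measurable_funM; first exact: measurable_powR.
by apply: measurableT_comp => //; exact: measurable_expR.
Qed.

(** The half-line is exhausted by the rays $[1/(k+1), +\infty[$. On each the integral is at most
    [K], and monotone convergence carries the bound to the limit. *)
Lemma Gamma_integral_lty s : 0 < s ->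
  (\int[@lebesgue_measure R]_(t in `]0%R, +oo[) (t `^ (s - 1) * expR (- t))%:E < +oo)%E.
Proof.
move=> s0; have [K K0 leK] := integrand_le s0.
pose D (k : nat) : set R := `[k.+1%:R^-1, +oo[%classic.
have -> : `]0, +oo[%classic = \bigcup_k D k.
  apply/seteqP; split=> x /=; rewrite ?in_itv/= ?andbT.
    move=> x0; exists (Num.truncn x^-1) => //=; rewrite /D/= in_itv/= andbT.
    by rewrite invf_ple ?posrE//; apply/ltW/truncnS_gt.
  move=> [k _]; rewrite /D/= in_itv/= andbT; apply: lt_le_trans.
  by rewrite invr_gt0.
apply: (@le_lt_trans _ _ K%:E); last exact: ltry.
have mf := measurable_Gamma_integrand s.
have c : (\int[@lebesgue_measure R]_(t in D k) (t `^ (s - 1) * expR (- t))%:E @[k --> \oo] -->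
    \int[@lebesgue_measure R]_(t in \bigcup_k D k) (t `^ (s - 1) * expR (- t))%:E)%E.
  apply: ge0_nondecreasing_set_cvg_integral.
  - apply/nondecreasing_seqP => k; rewrite subsetEset => x; rewrite /D/= !in_itv/= !andbT.
    by apply: le_trans; rewrite lef_pV2 ?posrE// ler_nat.
  - by move=> k; exact: measurable_itv.
  - by move=> k; apply: measurable_funTS.
  - by move=> k x _; rewrite lee_fin mulr_ge0 ?powR_ge0 ?expR_ge0.
apply: (cvge_le _ c); apply: nearW => k.
have Dgt0 (x : R) : D k x -> 0 < x.
  by rewrite /D/= in_itv/= andbT; apply: lt_le_trans; rewrite invr_gt0.
have mdF : measurable_fun (D k) (fun t => (dF s t)%:E).
  apply/measurable_EFinP.
  have : measurable_fun (`]0%R, +oo[%classic : set R) (dF s).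
    apply: open_continuous_measurable_fun; first exact: interval_open.
    by move=> x; rewrite inE/= in_itv/= andbT; exact: continuous_dF.
  apply: measurable_funS; first exact: measurable_itv.
  by move=> x /Dgt0; rewrite /= in_itv/= andbT.
apply: (@le_trans _ _ (\int[@lebesgue_measure R]_(t in D k) (K%:E * (dF s t)%:E))%E).
  apply: ge0_le_integral => //; first exact: measurable_itv.
  - by move=> x _; rewrite lee_fin mulr_ge0 ?powR_ge0 ?expR_ge0.
  - exact: measurable_funTS.
  - exact: measurable_funeM.
  - by move=> x /Dgt0 x0; rewrite -EFinM lee_fin leK.
rewrite ge0_integralZl//=.
- rewrite -[leRHS]mule1; apply: lee_wpmul2l => //.
  by apply: integral_dF; rewrite ?invr_gt0.
- exact: measurable_itv.
- by move=> x Dx; rewrite lee_fin dF_ge0// ltW// Dgt0.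
Qed.

(** [Gamma] is the [fine] part of an extended integral, so positivity also requires finiteness. The
    lower bound comes from the interval $[1,2]$ alone. *)
Lemma Gamma_gt0 s : 0 < s -> 0 < Gamma s.
Proof.
move=> s0; rewrite /Gamma /Rintegral fine_gt0//= Gamma_integral_lty// andbT.
(* On $[1,2]$ one has $0 \le \ln t \le 2$, hence $t^{s-1} \ge e^{-2|s-1|}$, and $e^{-t} \ge
   e^{-2}$. *)
pose e : R := expR (- (2 * `|s - 1| + 2)).
apply: (@lt_le_trans _ _ (\int[@lebesgue_measure R]_(t in `[1%R, 2%R]) e%:E)%E).
  rewrite integral_cst//= lebesgue_measure_itv/= lte_fin ltr1n.
  rewrite -EFinD -EFinM lte_fin mulr_gt0 ?expR_gt0//; lra.
have mf := measurable_Gamma_integrand s.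
apply: (@le_trans _ _ (\int[@lebesgue_measure R]_(t in `[1%R, 2%R])
    (t `^ (s - 1) * expR (- t))%:E)%E).
  apply: ge0_le_integral => //.
  - by move=> x _; rewrite lee_fin expR_ge0.
  - exact: measurable_funTS.
  - move=> x; rewrite /= in_itv/= => /andP[x1 x2]; rewrite lee_fin.
    have x0 : 0 < x by lra.
    rewrite /powR gt_eqF// -expRD ler_expR.
    have : - (`|s - 1| * 2) <= (s - 1) * ln x.
      rewrite lerNl; apply: le_trans (ler_norm _) _; rewrite normrN normrM.
      apply: ler_pM => //; rewrite ger0_norm ?ln_ge0//.
      by apply: le_trans (ltW (ln_sublinear x0)) _.
    lra.
apply: ge0_subset_integral => //.
- exact: measurable_funTS.
- by move=> x _; rewrite lee_fin mulr_ge0 ?powR_ge0 ?expR_ge0.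
- by move=> x/=; rewrite !in_itv/= andbT => /andP[x1 _]; lra.
Qed.

End Gamma.

Lemma c_alpha_gt0 (R : realType) (n : nat) (alpha : R) : -1 < alpha ->
  0 < c_alpha n alpha.
Proof.
move=> a1; have n0 : 0 <= n%:R :> R by [].
rewrite /c_alpha divr_gt0// ?mulr_gt0 ?Gamma_gt0 ?ltr0n ?fact_gt0//; lra.
Qed.

(** * Boxes and the normalized volume *)

Section box.
Variables (R : realType) (n : nat).
Implicit Types (z w t : n.-tuple R[i]) (d : R).

Definition square (x : R[i]) d : set R[i] :=
  [set y | ball (complex.Re x) d (complex.Re y) /\
           ball (complex.Im x) d (complex.Im y)].

Definition box z d : set (n.-tuple R[i]) :=
  [set t | forall i, square (tnth z i) d (tnth t i)].

(** This is the Euclidean neighbourhood filter of [z], with cubes as a base because their volume is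
    an explicit product. *)
Definition near_box z : set_system (n.-tuple R[i]) :=
  filter_from [set d | 0 < d] (box z).

Lemma measurable_square (x : R[i]) d : measurable (square x d).
Proof.
rewrite (_ : square x d = (@complex.Re R @^-1` ball (complex.Re x) d) `&`
  (@complex.Im R @^-1` ball (complex.Im x) d)) //.
apply: measurableI; rewrite -[X in measurable X]setTI.
  by apply: measurable_Re => //; exact: measurable_ball.
by apply: measurable_Im => //; exact: measurable_ball.
Qed.

Lemma lebesgueC_square (x : R[i]) d : 0 < d ->
  lebesgueC (square x d) = ((d *+ 2) ^+ 2)%:E.
Proof.
move=> d0; rewrite /lebesgueC /product_image /pushforward.
rewrite (_ : _ @^-1` _ = ball (complex.Re x) d `*` ball (complex.Im x) d)//.
rewrite product_measure1E//; try exact: measurable_ball.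
by rewrite expr2 EFinM; congr (_ * _)%E; apply: lebesgue_measure_ball; exact: ltW.
Qed.

Lemma measurable_box z d : measurable (box z d).
Proof.
rewrite (_ : box z d = \bigcap_(i in [set: 'I_n])
    ((@tnth _ _ ^~ i) @^-1` square (tnth z i) d)).
  apply: fin_bigcap_measurable => // i _; rewrite -[X in measurable X]setTI.
  by apply: (measurable_tnth i) => //; exact: measurable_square.
by apply/seteqP; split=> t /= At i; [move=> _; exact: At|exact: (At i I)].
Qed.

Lemma vol_box z d : 0 < d -> vol (box z d) = (((d *+ 2) ^+ 2) ^+ n)%:E.
Proof.
move=> d0; transitivity (\prod_(i < n) lebesgueC (square (tnth z i) d))%E.
  apply: (@tuple_measure_box _ _ _ _ n (fun i => square (tnth z i) d)) => i.
  exact: measurable_square.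
under eq_bigr do rewrite lebesgueC_square//.
elim: {z} n => [|m IH]; first by rewrite big_ord0 expr0.
by rewrite big_ord_recl IH -EFinM -exprS.
Qed.

Lemma vol_box_gt0 z d : 0 < d -> (0 < vol (box z d))%E.
Proof. by move=> d0; rewrite vol_box// lte_fin !exprn_gt0// pmulrn_rgt0. Qed.

Global Instance near_box_proper z : ProperFilter (near_box z).
Proof.
apply: filter_from_proper; last first.
  by move=> d d0; exists z => i; split; exact: ballxx.
apply: filter_from_filter; first by exists 1 => /=.
move=> d e d0 e0; exists (Num.min d e); first by rewrite /= lt_min d0.
move=> t zt; split=> i; have [] := zt i; split;
  apply: le_ball (_ : Num.min d e <= _) _ _ => //;
  by rewrite ge_min lexx ?orbT.
Qed.

Lemma cvg_near_box_Re z i :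
  complex.Re (tnth t i) @[t --> near_box z] --> complex.Re (tnth z i).
Proof. by apply/cvgrPdist_lt => e e0; exists e => // t /(_ i) []. Qed.

Lemma cvg_near_box_Im z i :
  complex.Im (tnth t i) @[t --> near_box z] --> complex.Im (tnth z i).
Proof. by apply/cvgrPdist_lt => e e0; exists e => // t /(_ i) []. Qed.

Lemma cvg_sum_ord {T : Type} {F : set_system T} {FF : Filter F} m
    (f : 'I_m -> T -> R) (l : 'I_m -> R) :
  (forall i, f i x @[x --> F] --> l i) ->
  \sum_(i < m) f i x @[x --> F] --> \sum_(i < m) l i.
Proof.
elim: m f l => [|m IH] f l fl.
  by rewrite big_ord0; under eq_fun do rewrite big_ord0; exact: cvg_cst.
rewrite big_ord_recl; under eq_fun do rewrite big_ord_recl.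
by apply: cvgD => //; apply: IH => i; exact: fl.
Qed.

Lemma normc_sqr (x : R[i]) :
  Normc.normc x ^+ 2 = complex.Re x ^+ 2 + complex.Im x ^+ 2.
Proof. by case: x => a b /=; rewrite sqr_sqrtr// addr_ge0 ?sqr_ge0. Qed.

Lemma hnorm_sqr z : hnorm z ^+ 2 =
  \sum_(i < n) (complex.Re (tnth z i) ^+ 2 + complex.Im (tnth z i) ^+ 2).
Proof.
rewrite sqr_sqrtr; last by apply: sumr_ge0 => i _; exact: sqr_ge0.
by apply: eq_bigr => i _; exact: normc_sqr.
Qed.

Lemma hnorm_ge0 z : 0 <= hnorm z. Proof. exact: sqrtr_ge0. Qed.

(** The squared norm is a polynomial in the real coordinates, the form suited to limits and
    estimates. *)
Lemma cball_hnorm_sqr z : cball z = (hnorm z ^+ 2 < 1) :> Prop.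
Proof.
by rewrite /cball/= -(@ltr_pXn2r _ 2 _ (hnorm z) 1) ?nnegrE ?hnorm_ge0// expr1n.
Qed.

Lemma cvg_near_box_hnorm_sqr z : hnorm t ^+ 2 @[t --> near_box z] --> hnorm z ^+ 2.
Proof.
rewrite hnorm_sqr; under eq_fun do rewrite hnorm_sqr.
apply: cvg_sum_ord => i.
by apply: cvgD; rewrite expr2; apply: cvgM;
  (exact: cvg_near_box_Re || exact: cvg_near_box_Im).
Qed.

Lemma near_box_cball z : cball z -> \forall t \near near_box z, cball t.
Proof.
rewrite cball_hnorm_sqr => z1; have /cvgr_lt/(_ _ z1) := @cvg_near_box_hnorm_sqr z.
by apply: filterS => t; rewrite cball_hnorm_sqr.
Qed.

Lemma cball0 : @cball R n [tuple of nseq n 0].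
Proof.
rewrite cball_hnorm_sqr hnorm_sqr big1// => i _.
by rewrite tnth_nseq /= expr0n/= addr0.
Qed.

Lemma cball_sub_box : @cball R n `<=` box [tuple of nseq n 0] 1.
Proof.
move=> t; rewrite cball_hnorm_sqr hnorm_sqr => t1 i.
have {t1} : complex.Re (tnth t i) ^+ 2 + complex.Im (tnth t i) ^+ 2 < 1.
  apply: le_lt_trans t1; rewrite (bigD1 i)//= lerDl.
  by apply: sumr_ge0 => j _; rewrite addr_ge0 ?sqr_ge0.
rewrite tnth_nseq => t1; have ab1 (a b : R) : a ^+ 2 + b ^+ 2 < 1 -> ball (0 : R) 1 a.
  move=> ab; rewrite /ball/= sub0r normrN.
  rewrite -(@ltr_pXn2r _ 2 _ `|a| 1) ?nnegrE// expr1n real_normK ?num_real//.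
  by apply: le_lt_trans ab; rewrite lerDl sqr_ge0.
by split; [exact: ab1 t1|move: t1; rewrite addrC; exact: ab1].
Qed.

(** Together with finiteness of the volume, this makes the scaling factor of [nvol] a genuine
    positive inverse instead of the default value 0. *)
Lemma vol_cball_gt0 : (0 < @vol R n (@cball R n))%E.
Proof.
have [d d0 dB] := near_box_cball cball0.
apply: (lt_le_trans (vol_box_gt0 _ d0)).
by apply: le_measure; rewrite ?inE; [exact: measurable_box|exact: measurable_cball|exact: dB].
Qed.

Lemma vol_cball_lty : (@vol R n (@cball R n) < +oo)%E.
Proof.
apply: (@le_lt_trans _ _ (vol (box [tuple of nseq n 0] 1))).
  apply: le_measure; rewrite ?inE; [exact: measurable_cball|exact: measurable_box|].
  exact: cball_sub_box.
by rewrite vol_box// ltry.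
Qed.

Lemma nvol_setC_cball : @nvol R n (~` @cball R n) = 0%E.
Proof. by rewrite /nvol /mscale/= /mrestr setICl measure0 mule0. Qed.

Lemma nvol_box_gt0 z d : 0 < d -> box z d `<=` @cball R n -> (0 < @nvol R n (box z d))%E.
Proof.
move=> d0 dB; rewrite /nvol /mscale/= /mrestr (setIidl dB).
rewrite mule_gt0//; last exact: vol_box_gt0.
by rewrite lte_fin invr_gt0 fine_gt0// vol_cball_gt0 vol_cball_lty.
Qed.

Lemma nvolT : (@nvol R n setT < +oo)%E.
Proof.
rewrite /nvol /mscale/= /mrestr setTI.
by rewrite lte_mul_pinfty// ?lee_fin ?invr_ge0 ?fine_ge0// vol_cball_lty.
Qed.

(** Finiteness supplies the sigma-finiteness for Tonelli and makes the mass of every box a real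
    number. *)
HB.instance Definition _ := Measure_isFinite.Build _ _ _ (@nvol R n)
  (lty_fin_num_fun nvolT).

End box.

(** * The kernels *)

(** The identity $x^{-1} = x\,(x^2)^{-1}$ reduces inversion to a real power of a nonnegative number.
    At $x = 0$ both sides are 0 by convention. *)
Lemma measurable_invr (R : realType) : measurable_fun [set: R] (@GRing.inv R).
Proof.
rewrite (_ : @GRing.inv R = fun x => x * (x ^+ 2) `^ (-1)); last first.
  apply/funext => x; rewrite powR_inv1 ?sqr_ge0//.
  have [->|x0] := eqVneq x 0; first by rewrite invr0 mul0r.
  by field.
apply: measurable_funM => //.
apply: (measurableT_comp (measurable_powR _)).
exact: exprn_measurable.
Qed.

Section phase_kernel.
Local Open Scope complex_scope.
Variables (R : realType) (n : nat).
Implicit Types (z w t : n.-tuple R[i]) (a b c d alpha : R) (x y : R[i]).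
Implicit Types (phi : n.-tuple R[i] -> n.-tuple R[i] -> R).
Local Notation Re := (@complex.Re R).
Local Notation Im := (@complex.Im R).
Local Notation normc := (@Normc.normc R).

Lemma Re_mulc x y : Re (x * y) = Re x * Re y - Im x * Im y.
Proof. by case: x y => ? ? []. Qed.

Lemma Im_mulc x y : Im (x * y) = Re x * Im y + Im x * Re y.
Proof. by case: x y => ? ? []. Qed.

Lemma Re_hdot z w : Re (hdot z w) =
  \sum_(i < n) (Re (tnth z i) * Re (tnth w i) + Im (tnth z i) * Im (tnth w i)).
Proof.
rewrite /hdot (@big_morph _ _ Re 0 +%R)//; last by case=> ? ? [].
apply: eq_bigr => i _; case: (tnth z i) (tnth w i) => ? ? [? ?] /=.
by rewrite mulrN opprK.
Qed.

Lemma Im_hdot z w : Im (hdot z w) =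
  \sum_(i < n) (Im (tnth z i) * Re (tnth w i) - Re (tnth z i) * Im (tnth w i)).
Proof.
rewrite /hdot (@big_morph _ _ Im 0 +%R)//; last by case=> ? ? [].
apply: eq_bigr => i _; case: (tnth z i) (tnth w i) => ? ? [? ?] /=.
by rewrite mulrN addrC.
Qed.

Definition rho z w : R := normc (1 - hdot z w).

Lemma rho_sqr z w : rho z w ^+ 2 = (1 - Re (hdot z w)) ^+ 2 + Im (hdot z w) ^+ 2.
Proof. by rewrite /rho normc_sqr; case: (hdot z w) => ? ? /=; rewrite sub0r sqrrN. Qed.

Lemma rho_ge0 z w : 0 <= rho z w.
Proof. by rewrite /rho; case: (1 - _) => ? ?; exact: sqrtr_ge0. Qed.

(** Coordinatewise, $|pr+qs| \le (p^2+q^2+r^2+s^2)/2$, because $(p\pm r)^2$ and $(q\pm s)^2$ are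
    nonnegative. This mean of squares turns directly into the mean of $1-|z|^2$ and $1-|w|^2$
    below. *)
Lemma normr_Re_hdot_le z w :
  `|Re (hdot z w)| <= (hnorm z ^+ 2 + hnorm w ^+ 2) / 2.
Proof.
rewrite Re_hdot !hnorm_sqr -big_split/= mulr_suml.
apply: le_trans (ler_norm_sum _ _ _) _; apply: ler_sum => i _.
move: (Im (tnth w i)) (Re (tnth w i)) (Im (tnth z i)) (Re (tnth z i)) => s r q p.
have := sqr_ge0 (p - r); have := sqr_ge0 (q - s).
have := sqr_ge0 (p + r); have := sqr_ge0 (q + s).
by rewrite ler_norml => *; apply/andP; split; nra.
Qed.

Lemma normr_Im_hdot_le z w :
  `|Im (hdot z w)| <= (hnorm z ^+ 2 + hnorm w ^+ 2) / 2.
Proof.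
rewrite Im_hdot !hnorm_sqr -big_split/= mulr_suml.
apply: le_trans (ler_norm_sum _ _ _) _; apply: ler_sum => i _.
move: (Im (tnth w i)) (Re (tnth w i)) (Im (tnth z i)) (Re (tnth z i)) => s r q p.
have := sqr_ge0 (q - r); have := sqr_ge0 (p - s).
have := sqr_ge0 (q + r); have := sqr_ge0 (p + s).
by rewrite ler_norml => *; apply/andP; split; nra.
Qed.

(** On the ball this makes $\operatorname{Re}(1-\langle z,w\rangle)$ positive, so the principal
    branch is given by the arctangent formula. *)
Lemma Re_1sub_hdot_ge z w :
  (1 - hnorm z ^+ 2) / 2 + (1 - hnorm w ^+ 2) / 2 <= 1 - Re (hdot z w).
Proof. by have := le_trans (ler_norm _) (normr_Re_hdot_le z w); lra. Qed.

Lemma rho_ge z w : (1 - hnorm z ^+ 2) / 2 + (1 - hnorm w ^+ 2) / 2 <= rho z w.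
Proof.
apply: le_trans (Re_1sub_hdot_ge z w) _; apply: le_trans (ler_norm _) _.
rewrite -(@ler_pXn2r _ 2) ?nnegrE ?rho_ge0// real_normK ?num_real// rho_sqr.
by rewrite lerDl sqr_ge0.
Qed.

Lemma rho_le z w : cball z -> cball w -> rho z w <= 3.
Proof.
rewrite !cball_hnorm_sqr => z1 w1.
have /ler_normlP[r1 r2] := normr_Re_hdot_le z w.
have /ler_normlP[i1 i2] := normr_Im_hdot_le z w.
rewrite -(@ler_pXn2r _ 2) ?nnegrE ?rho_ge0// rho_sqr.
(* With $x = \operatorname{Re}(1-\langle z,w\rangle)$ in $[0,2]$ and $y = \operatorname{Im}\langle
   z,w\rangle$ in $[-1,1]$, one gets $x^2 + y^2 \le 2x + 1 \le 5 \le 9$. *)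
have : 0 <= (2 - (1 - Re (hdot z w))) * (1 - Re (hdot z w)) by apply: mulr_ge0; lra.
have : 0 <= (1 - Im (hdot z w)) * (1 + Im (hdot z w)) by apply: mulr_ge0; lra.
nra.
Qed.

Definition kernel_mod b c z w : R := (1 - hnorm w ^+ 2) `^ b / rho z w `^ c.

(* The common form of the two kernels: [S_kernel] has phase [0], [T_kernel] has
   as phase [c] times the principal argument of [1 - hdot z w]. *)
Definition phase_kernel b c phi z w : R[i] :=
  (kernel_mod b c z w * cos (phi z w)) -i* (kernel_mod b c z w * sin (phi z w)).

Definition phase c z w : R :=
  c * atan (Im (1 - hdot z w) / Re (1 - hdot z w)).

Lemma S_kernelE b c : S_kernel n b c = phase_kernel b c (fun _ _ => 0).
Proof.
apply/funext => z; apply/funext => w.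
by rewrite /phase_kernel cos0 sin0 mulr1 mulr0 oppr0.
Qed.

Lemma T_kernelE b c : T_kernel n b c = phase_kernel b c (phase c).
Proof.
apply/funext => z; apply/funext => w.
rewrite /T_kernel /cpow /phase_kernel /kernel_mod -/(rho z w) -/(phase c z w) invfM.
rewrite -fmorphV mulrA -rmorphM.
set A := (1 - hnorm w ^+ 2) `^ b / rho z w `^ c; set p := phase c z w.
(* The inverse of a complex number of modulus one is its conjugate; this accounts for the minus sign
   in [phase_kernel]. *)
have -> : (cos p +i* sin p)^-1 = cos p -i* sin p.
  by rewrite /GRing.inv/= cos2Dsin2 !divr1.
by rewrite /GRing.mul/= !mul0r subr0 addr0 mulrN.
Qed.

Lemma normc_phase_kernel b c phi z w :
  normc (phase_kernel b c phi z w) = kernel_mod b c z w.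
Proof.
have : 0 <= kernel_mod b c z w by rewrite divr_ge0 ?powR_ge0.
rewrite /phase_kernel; move: (kernel_mod _ _ _ _) => A A0 /=.
by rewrite sqrrN !exprMn -mulrDr cos2Dsin2 mulr1 sqrtr_sqr ger0_norm.
Qed.

Let near_pair z0 w0 := filter_prod (near_box z0) (near_box w0).

Lemma cvg_hdot z0 w0 :
  (Re (hdot p.1 p.2) @[p --> near_pair z0 w0] --> Re (hdot z0 w0)) /\
  (Im (hdot p.1 p.2) @[p --> near_pair z0 w0] --> Im (hdot z0 w0)).
Proof.
have r1 i : Re (tnth p.1 i) @[p --> near_pair z0 w0] --> Re (tnth z0 i).
  exact: (cvg_comp fst (fun z => Re (tnth z i)) cvg_fst (@cvg_near_box_Re _ _ _ _)).
have i1 i : Im (tnth p.1 i) @[p --> near_pair z0 w0] --> Im (tnth z0 i).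
  exact: (cvg_comp fst (fun z => Im (tnth z i)) cvg_fst (@cvg_near_box_Im _ _ _ _)).
have r2 i : Re (tnth p.2 i) @[p --> near_pair z0 w0] --> Re (tnth w0 i).
  exact: (cvg_comp snd (fun z => Re (tnth z i)) cvg_snd (@cvg_near_box_Re _ _ _ _)).
have i2 i : Im (tnth p.2 i) @[p --> near_pair z0 w0] --> Im (tnth w0 i).
  exact: (cvg_comp snd (fun z => Im (tnth z i)) cvg_snd (@cvg_near_box_Im _ _ _ _)).
split; rewrite ?Re_hdot ?Im_hdot.
  under eq_fun do rewrite Re_hdot.
  by apply: cvg_sum_ord => i; apply: cvgD; apply: cvgM.
under eq_fun do rewrite Im_hdot.
by apply: cvg_sum_ord => i; apply: cvgB; apply: cvgM.
Qed.

Lemma Re_1sub z w : Re (1 - hdot z w) = 1 - Re (hdot z w).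
Proof. by case: (hdot z w). Qed.

Lemma Im_1sub z w : Im (1 - hdot z w) = - Im (hdot z w).
Proof. by case: (hdot z w) => ? ? /=; rewrite sub0r. Qed.

Lemma rho_gt0 z w : cball z -> cball w -> 0 < rho z w.
Proof. by rewrite !cball_hnorm_sqr => z1 w1; have := rho_ge z w; lra. Qed.

Lemma cvg_rho z0 w0 : rho p.1 p.2 @[p --> near_pair z0 w0] --> rho z0 w0.
Proof.
have [cr ci] := cvg_hdot z0 w0.
rewrite (_ : rho z0 w0 = Num.sqrt ((1 - Re (hdot z0 w0)) ^+ 2 + Im (hdot z0 w0) ^+ 2));
  last by rewrite -rho_sqr sqrtr_sqr ger0_norm ?rho_ge0.
rewrite (_ : (fun p => _) = (fun p =>
    Num.sqrt ((1 - Re (hdot p.1 p.2)) ^+ 2 + Im (hdot p.1 p.2) ^+ 2)));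
  last by apply/funext => p; rewrite -rho_sqr sqrtr_sqr ger0_norm ?rho_ge0.
apply: (continuous_cvg _ (@sqrt_continuous _ _)).
have c1 : 1 - Re (hdot p.1 p.2) @[p --> near_pair z0 w0] --> 1 - Re (hdot z0 w0).
  by apply: cvgB => //; exact: cvg_cst.
by rewrite !expr2; apply: cvgD; apply: cvgM.
Qed.

(** The denominator inside the arctangent has a positive limit on the ball, so the principal
    argument is continuous there. *)
Lemma cvg_phase c z0 w0 : cball z0 -> cball w0 ->
  phase c p.1 p.2 @[p --> near_pair z0 w0] --> phase c z0 w0.
Proof.
move=> z1 w1; have [cr ci] := cvg_hdot z0 w0.
apply: cvgM; first exact: cvg_cst.
apply: (continuous_cvg _ (@continuous_atan _ _)).
rewrite Re_1sub Im_1sub; under eq_fun do rewrite Re_1sub Im_1sub.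
apply: cvgM; first exact: cvgN.
apply: cvgV; last by apply: cvgB => //; exact: cvg_cst.
move: z1 w1; rewrite !cball_hnorm_sqr; have := Re_1sub_hdot_ge z0 w0.
by move=> h z1 w1; rewrite gt_eqF//; lra.
Qed.

Lemma cvg_kernel_mod b c z0 w0 : cball z0 -> cball w0 ->
  kernel_mod b c p.1 p.2 @[p --> near_pair z0 w0] --> kernel_mod b c z0 w0.
Proof.
move=> z1 w1; apply: cvgM.
  apply: (cvg_comp (fun p => 1 - hnorm p.2 ^+ 2) (@powR R ^~ b)).
    apply: cvgB; first exact: cvg_cst.
    exact: (cvg_comp snd (fun z => hnorm z ^+ 2) cvg_snd (@cvg_near_box_hnorm_sqr _ _ _)).
  by apply: continuous_powR_gt0; move: w1; rewrite cball_hnorm_sqr subr_gt0.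
apply: cvgV; first by rewrite gt_eqF// powR_gt0// rho_gt0.
apply: (cvg_comp (fun p => rho p.1 p.2) (@powR R ^~ c)); first exact: cvg_rho.
by apply: continuous_powR_gt0; rewrite rho_gt0.
Qed.

Lemma cvg_phase_kernel b c phi z0 w0 : cball z0 -> cball w0 ->
  phi p.1 p.2 @[p --> near_pair z0 w0] --> phi z0 w0 ->
  (Re (phase_kernel b c phi p.1 p.2) @[p --> near_pair z0 w0] -->
     Re (phase_kernel b c phi z0 w0)) /\
  (Im (phase_kernel b c phi p.1 p.2) @[p --> near_pair z0 w0] -->
     Im (phase_kernel b c phi z0 w0)).
Proof.
move=> z1 w1 cphi; split=> /=.
  apply: cvgM; first exact: cvg_kernel_mod.
  exact: (continuous_cvg _ (@continuous_cos _ _)).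
apply: cvgN; apply: cvgM; first exact: cvg_kernel_mod.
exact: (continuous_cvg _ (@continuous_sin _ _)).
Qed.

End phase_kernel.

(** * Integral operators with a dominated kernel *)

Section complex_integral.
Context d (T : measurableType d) (R : realType).
Implicit Types (D : set T) (f g : T -> R[i]).
Local Notation Re := (@complex.Re R).
Local Notation Im := (@complex.Im R).
Local Notation normc := (@Normc.normc R).

Lemma measurable_complex f : measurable_fun setT (Re \o f) ->
  measurable_fun setT (Im \o f) -> measurable_fun setT f.
Proof.
move=> mr mi; rewrite (_ : f = @pair_complex R \o
    (fun x => ((Re \o f) x : measurableTypeR R, (Im \o f) x : measurableTypeR R))).
  apply: measurableT_comp; first exact: measurable_pair_complex.
  exact: (measurable_fun_pair mr mi).
by apply/funext => x /=; rewrite /pair_complex/=; case: (f x).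
Qed.

Lemma measurable_Re_mulc D f g : measurable_fun D (Re \o f) -> measurable_fun D (Im \o f) ->
  measurable_fun D g -> measurable_fun D (fun x => Re (f x * g x)).
Proof.
move=> mr mi mg; under eq_fun do rewrite Re_mulc.
apply: measurable_funB; apply: measurable_funM => //.
  by apply: measurableT_comp mg; exact: measurable_Re.
by apply: measurableT_comp mg; exact: measurable_Im.
Qed.

Lemma measurable_Im_mulc D f g : measurable_fun D (Re \o f) -> measurable_fun D (Im \o f) ->
  measurable_fun D g -> measurable_fun D (fun x => Im (f x * g x)).
Proof.
move=> mr mi mg; under eq_fun do rewrite Im_mulc.
apply: measurable_funD; apply: measurable_funM => //.
  by apply: measurableT_comp mg; exact: measurable_Im.
by apply: measurableT_comp mg; exact: measurable_Re.
Qed.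

Lemma normc_ge0 (x : R[i]) : 0 <= normc x.
Proof. by case: x => *; exact: sqrtr_ge0. Qed.

Lemma normc_Re_le (x : R[i]) : `|Re x| <= normc x.
Proof.
case: x => p q /=; rewrite -sqrtr_sqr ler_sqrt ?addr_ge0 ?sqr_ge0//.
by rewrite lerDl sqr_ge0.
Qed.

Lemma normc_Im_le (x : R[i]) : `|Im x| <= normc x.
Proof.
case: x => p q /=; rewrite -sqrtr_sqr ler_sqrt ?addr_ge0 ?sqr_ge0//.
by rewrite lerDr sqr_ge0.
Qed.

Lemma normc_le_ReIm (x : R[i]) : normc x <= `|Re x| + `|Im x|.
Proof.
rewrite -(@ler_pXn2r _ 2) ?nnegrE ?addr_ge0//; last exact: normc_ge0.
rewrite normc_sqr sqrrD !real_normK ?num_real// -addrA addrCA addrC -addrA.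
by rewrite lerD2l ler_wpDr// mulrn_wge0// mulr_ge0.
Qed.

Variable mu : {measure set T -> \bar R}.

(** The finite bound on the integral of [k] first yields integrability of [h]; only then does the
    real integral obey the triangle inequality. *)
Lemma normr_Rintegral_le D (h : T -> R) (k : T -> R) (B : R) : measurable D ->
  measurable_fun D h -> measurable_fun D k -> (forall x, D x -> `|h x| <= k x) ->
  (\int[mu]_(x in D) (k x)%:E <= B%:E)%E -> `|\int[mu]_(x in D) h x| <= B.
Proof.
move=> mD mh mk hk kB.
have le1 : (\int[mu]_(x in D) `|(h x)%:E| <= B%:E)%E.
  apply: le_trans kB; apply: ge0_le_integral => //.
  - by apply: measurableT_comp => //; exact/measurable_EFinP.
  - exact/measurable_EFinP.
have ih : mu.-integrable D (EFin \o h).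
  apply/integrableP; split; first exact/measurable_EFinP.
  by apply: le_lt_trans le1 _; exact: ltry.
rewrite -lee_fin (EFin_normr_Rintegral mD ih).
apply: le_trans (le1); apply: le_abse_integral => //; exact/measurable_EFinP.
Qed.

End complex_integral.

(** * Measurability of integrals depending on a parameter *)

Section param_integral.
Context d1 d2 (T1 : measurableType d1) (T2 : measurableType d2) (R : realType).
Variable m : {sigma_finite_measure set T2 -> \bar R}.

(** Tonelli applies to the positive and negative parts separately; their difference and [fine]
    preserve measurability. *)
Lemma measurable_Rintegral_param (h : T1 * T2 -> R) :
  measurable_fun setT h ->
  measurable_fun setT (fun x => \int[m]_y h (x, y)).
Proof.
move=> mh; have mE : measurable_fun setT (EFin \o h) by exact/measurable_EFinP.
apply: (measurableT_comp (@fine_measurable R setT measurableT)).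
under eq_fun do rewrite integralE.
apply: emeasurable_funB.
  have := @measurable_fun_fubini_tonelli_F _ _ _ _ _ m _ (measurable_funepos mE) (funepos_ge0 _).
  by congr measurable_fun; apply/funext => x; apply: eq_integral => y _; rewrite !funeposE.
have := @measurable_fun_fubini_tonelli_F _ _ _ _ _ m _ (measurable_funeneg mE) (funeneg_ge0 _).
by congr measurable_fun; apply/funext => x; apply: eq_integral => y _; rewrite !funenegE.
Qed.

End param_integral.

(** * Measurability and boundedness of the integral operators *)

Section operator.
Variables (R : realType) (n : nat).
Implicit Types (z w t : n.-tuple R[i]) (a b c alpha : R) (f : n.-tuple R[i] -> R[i]).
Implicit Types (phi : n.-tuple R[i] -> n.-tuple R[i] -> R).
Local Notation Re := (@complex.Re R).
Local Notation Im := (@complex.Im R).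
Local Notation normc := (@Normc.normc R).
Local Notation T := (n.-tuple R[i]).

Lemma measurable_hdot :
  measurable_fun setT (fun p : T * T => Re (hdot p.1 p.2)) /\
  measurable_fun setT (fun p : T * T => Im (hdot p.1 p.2)).
Proof.
have r1 i : measurable_fun setT (fun p : T * T => Re (tnth p.1 i)).
  exact: (measurableT_comp (@measurable_Re R)
    (measurableT_comp (measurable_tnth i) measurable_fst)).
have i1 i : measurable_fun setT (fun p : T * T => Im (tnth p.1 i)).
  exact: (measurableT_comp (@measurable_Im R)
    (measurableT_comp (measurable_tnth i) measurable_fst)).
have r2 i : measurable_fun setT (fun p : T * T => Re (tnth p.2 i)).
  exact: (measurableT_comp (@measurable_Re R)
    (measurableT_comp (measurable_tnth i) measurable_snd)).
have i2 i : measurable_fun setT (fun p : T * T => Im (tnth p.2 i)).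
  exact: (measurableT_comp (@measurable_Im R)
    (measurableT_comp (measurable_tnth i) measurable_snd)).
split.
  under eq_fun do rewrite Re_hdot.
  by apply: measurable_sum => i; apply: measurable_funD; apply: measurable_funM.
under eq_fun do rewrite Im_hdot.
by apply: measurable_sum => i; apply: measurable_funB; apply: measurable_funM.
Qed.

Lemma measurable_rho : measurable_fun setT (fun p : T * T => rho p.1 p.2).
Proof.
have [mr mi] := measurable_hdot.
apply: (measurableT_comp (@measurable_normc R)); apply: measurable_complex => /=.
  rewrite /comp; under eq_fun do rewrite Re_1sub.
  exact: measurable_funB.
rewrite /comp; under eq_fun do rewrite Im_1sub.
exact: measurable_funN.
Qed.

Lemma measurable_phase c : measurable_fun setT (fun p : T * T => phase c p.1 p.2).
Proof.
have [mr mi] := measurable_hdot.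
apply: measurable_funM => //.
apply: (measurableT_comp (continuous_measurable_fun (@continuous_atan R))).
under eq_fun do rewrite Re_1sub Im_1sub.
apply: measurable_funM; first exact: measurable_funN.
apply: (measurableT_comp (@measurable_invr R)).
exact: measurable_funB.
Qed.

Lemma measurable_kernel_mod b c : measurable_fun setT (fun p : T * T => kernel_mod b c p.1 p.2).
Proof.
apply: measurable_funM.
  apply: (measurableT_comp (measurable_powR b)); apply: measurable_funB => //.
  apply: measurable_funX.
  exact: (measurableT_comp (@measurable_hnorm R n) measurable_snd).
apply: (measurableT_comp (@measurable_invr R)).
apply: (measurableT_comp (measurable_powR c)).
exact: measurable_rho.
Qed.

Lemma measurable_phase_kernel b c phi :
  measurable_fun setT (fun p : T * T => phi p.1 p.2) ->
  measurable_fun setT (fun p : T * T => Re (phase_kernel b c phi p.1 p.2)) /\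
  measurable_fun setT (fun p : T * T => Im (phase_kernel b c phi p.1 p.2)).
Proof.
move=> mphi; split=> /=.
  apply: measurable_funM; first exact: measurable_kernel_mod.
  exact: (measurableT_comp (continuous_measurable_fun (@continuous_cos R))).
apply: measurable_funN.
apply: measurable_funM; first exact: measurable_kernel_mod.
exact: (measurableT_comp (continuous_measurable_fun (@continuous_sin R))).
Qed.

Definition jointly_measurable (k : T -> T -> R[i]) :=
  measurable_fun setT (fun p : T * T => Re (k p.1 p.2)) /\
  measurable_fun setT (fun p : T * T => Im (k p.1 p.2)).

Implicit Type k : T -> T -> R[i].

Lemma measurable_kernelM k f z : jointly_measurable k ->
  measurable_fun (@cball R n) f ->
  measurable_fun (@cball R n) (fun w => k z w * f w).
Proof.
move=> [kr ki] mf.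
(* The kernel is measurable everywhere but [f] only on the ball, so [f] is extended by zero. *)
have mg : measurable_fun setT (f \_ (@cball R n)).
  by apply/(measurable_restrictT _ (@measurable_cball R n)).
apply: (@eq_measurable_fun _ _ _ _ _ (fun w => k z w * (f \_ (@cball R n)) w)).
  by move=> w wB; rewrite patchE wB.
apply: measurable_funTS; apply: measurable_complex.
  apply: measurable_Re_mulc => //; first exact: (measurableT_comp kr (measurable_pair1 z)).
  exact: (measurableT_comp ki (measurable_pair1 z)).
apply: measurable_Im_mulc => //; first exact: (measurableT_comp kr (measurable_pair1 z)).
exact: (measurableT_comp ki (measurable_pair1 z)).
Qed.

Lemma measurable_fr_op a k f : jointly_measurable k ->
  measurable_fun (@cball R n) f -> measurable_fun (@cball R n) (fr_op a k f).
Proof.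
move=> [kr ki] mf.
have mg : measurable_fun setT (f \_ (@cball R n)).
  by apply/(measurable_restrictT _ (@measurable_cball R n)).
have mg2 : measurable_fun setT (fun p : T * T => (f \_ (@cball R n)) p.2).
  exact: measurableT_comp mg measurable_snd.
(* An integrand vanishing where [f] does lets the ball integral become one over the whole space, to
   which the parameter lemma applies. *)
have restrE (h : T -> R[i] -> R) : (forall w, h w 0 = 0) ->
  \int[@nvol R n]_(w in @cball R n) h w (f w) =
  \int[@nvol R n]_w h w ((f \_ (@cball R n)) w).
  move=> h0; rewrite Rintegral_mkcond; apply: eq_Rintegral => w _.
  by rewrite !patchE; case: ifP => // _; rewrite h0.
apply: measurable_funTS; rewrite /fr_op.
have mz : measurable_fun setT (fun z : T => ((1 - hnorm z ^+ 2) `^ a)%:C%C).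
  apply: measurable_complex; last exact: measurable_cst.
  apply: (measurableT_comp (measurable_powR a)); apply: measurable_funB => //.
  by apply: measurable_funX; exact: measurable_hnorm.
have mc : measurable_fun setT (fun z => cintegral (@cball R n) (fun w => k z w * f w)).
  apply: measurable_complex => /=; rewrite /comp /=.
    rewrite (_ : (fun z => _) = fun z =>
      \int[@nvol R n]_w Re (k z w * (f \_ (@cball R n)) w)); last first.
      by apply/funext => z; apply: (restrE (fun w y => Re (k z w * y))) => w; rewrite mulr0.
    apply: (measurable_Rintegral_param (@nvol R n)
      (h := fun p => Re (k p.1 p.2 * (f \_ (@cball R n)) p.2))).
    exact: measurable_Re_mulc.
  rewrite (_ : (fun z => _) = fun z =>
      \int[@nvol R n]_w Im (k z w * (f \_ (@cball R n)) w)); last first.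
      by apply/funext => z; apply: (restrE (fun w y => Im (k z w * y))) => w; rewrite mulr0.
  apply: (measurable_Rintegral_param (@nvol R n)
      (h := fun p => Im (k p.1 p.2 * (f \_ (@cball R n)) p.2))).
  exact: measurable_Im_mulc.
have mzr : measurable_fun setT (Re \o (fun z : T => ((1 - hnorm z ^+ 2) `^ a)%:C%C)).
  exact: measurableT_comp (@measurable_Re R) mz.
have mzi : measurable_fun setT (Im \o (fun z : T => ((1 - hnorm z ^+ 2) `^ a)%:C%C)).
  exact: measurableT_comp (@measurable_Im R) mz.
by apply: measurable_complex; [exact: measurable_Re_mulc|exact: measurable_Im_mulc].
Qed.

(** [cintegral] integrates real and imaginary parts separately, and each contributes at most [B];
    hence the factor 2. *)
Lemma normc_fr_op_le a k f z (B : R) :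
  measurable_fun (@cball R n) (fun w => k z w * f w) ->
  (\int[@nvol R n]_(w in @cball R n) (normc (k z w * f w))%:E <= B%:E)%E ->
  normc (fr_op a k f z) <= (1 - hnorm z ^+ 2) `^ a * (2 * B).
Proof.
move=> mkf iB; have mB := @measurable_cball R n.
have mn : measurable_fun (@cball R n) (fun w => normc (k z w * f w)).
  exact: measurableT_comp (@measurable_normc R) mkf.
rewrite /fr_op Normc.normcM.
rewrite (_ : normc ((1 - hnorm z ^+ 2) `^ a)%:C%C = (1 - hnorm z ^+ 2) `^ a); last first.
  by rewrite /= expr0n/= addr0 sqrtr_sqr ger0_norm ?powR_ge0.
apply: ler_wpM2l; first exact: powR_ge0.
apply: le_trans (normc_le_ReIm _) _; rewrite mulr_natl mulr2n lerD//=.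
  apply: (normr_Rintegral_le mB _ mn) => //.
    exact: measurableT_comp (@measurable_Re R) mkf.
  by move=> w _; exact: normc_Re_le.
apply: (normr_Rintegral_le mB _ mn) => //.
  exact: measurableT_comp (@measurable_Im R) mkf.
by move=> w _; exact: normc_Im_le.
Qed.

(** Domination bounds the integral of $|k(z,\cdot) f|$ by a multiple of
    $(1-|z|^2)^{-a}\|f\|_{1,\alpha}$. The outer factor $(1-|z|^2)^a$ cancels the dependence on
    $z$. *)
Lemma bounded_L1_Linf_kernel a alpha k (M : R) : -1 < alpha -> 0 <= M ->
  jointly_measurable k ->
  (forall z w, cball z -> cball w ->
    (1 - hnorm z ^+ 2) `^ a * normc (k z w) <= M * (1 - hnorm w ^+ 2) `^ alpha) ->
  bounded_L1_Linf alpha a k.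
Proof.
move=> alpha1 M0 mk leM.
have ca0 := c_alpha_gt0 n alpha1.
have mB := @measurable_cball R n.
have dens_ge0 (w : T) : 0 <= c_alpha n alpha * (1 - hnorm w ^+ 2) `^ alpha.
  by rewrite mulr_ge0 ?powR_ge0 ?(ltW ca0).
pose I f := fine (L1norm alpha f).
have L1fin f : in_L1 alpha f -> L1norm alpha f = (I f)%:E.
  move=> [_ L]; rewrite /I fineK// ge0_fin_numE// integral_ge0// => w _.
  by rewrite lee_fin mulr_ge0 ?normc_ge0 ?dens_ge0.
have key f : in_L1 alpha f -> forall z, cball z ->
    (\int[@nvol R n]_(w in @cball R n) (normc (k z w * f w))%:E
      <= (M / (c_alpha n alpha * (1 - hnorm z ^+ 2) `^ a) * I f)%:E)%E.
  move=> fL1 z z1; have [mf _] := fL1.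
  have z0 : 0 < (1 - hnorm z ^+ 2) `^ a.
    by apply: powR_gt0; move: z1; rewrite cball_hnorm_sqr subr_gt0.
  rewrite EFinM -L1fin// /L1norm.
  have mnf : measurable_fun (@cball R n) (fun w => normc (f w)).
    exact: measurableT_comp (@measurable_normc R) mf.
  have md : measurable_fun (@cball R n) (fun w =>
      (normc (f w) * (c_alpha n alpha * (1 - hnorm w ^+ 2) `^ alpha))%:E).
    apply/measurable_EFinP; apply: measurable_funM => //; apply: measurable_funTS.
    apply: measurable_funM => //.
    apply: (measurableT_comp (measurable_powR alpha)); apply: measurable_funB => //.
    by apply: measurable_funX; exact: measurable_hnorm.
  have C0 : 0 <= M / (c_alpha n alpha * (1 - hnorm z ^+ 2) `^ a).
    by rewrite divr_ge0// mulr_ge0// ?(ltW ca0) ?(ltW z0).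
  rewrite -ge0_integralZl//.
  - apply: ge0_le_integral => //.
    + by move=> w _; rewrite lee_fin normc_ge0.
    + apply/measurable_EFinP; apply: measurableT_comp (@measurable_normc R) _.
      exact: measurable_kernelM.
    + exact: measurable_funeM.
    + move=> w w1; rewrite -EFinM lee_fin Normc.normcM.
      have := leM _ _ z1 w1; move: (normc (k z w)) (normc (f w)) (normc_ge0 (f w)) => x y y0 h.
      rewrite (_ : _ / _ * _ =
        (M * (1 - hnorm w ^+ 2) `^ alpha) / (1 - hnorm z ^+ 2) `^ a * y); last first.
        by field; rewrite (gt_eqF ca0) (gt_eqF z0).
      by rewrite ler_wpM2r// ler_pdivlMr// mulrC.
  - by move=> w _; rewrite lee_fin mulr_ge0 ?normc_ge0 ?dens_ge0.
split.
  move=> f fL1 z z1; split; first by apply: measurable_kernelM => //; case: fL1.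
  by apply: le_lt_trans (key f fL1 z z1) _; exact: ltry.
(* The 2 comes from splitting into real and imaginary parts, and the division by [c_alpha] from the
   normalization of the density. *)
pose C := 2 * M / c_alpha n alpha; exists C => f fL1.
have bd : (Linfnorm (fr_op a k f) <= C%:E * L1norm alpha f)%E.
  rewrite L1fin// -EFinM; apply/ess_supP.
  (* The complement of the ball is null and serves as the exceptional set, so the bound has to be
     checked on the ball only. *)
  exists (~` @cball R n); split; [exact: measurableC|exact: nvol_setC_cball|].
  move=> z /=; apply: contra_not => z1; rewrite lee_fin.
  have z0 : 0 < (1 - hnorm z ^+ 2) `^ a.
    by apply: powR_gt0; move: z1; rewrite cball_hnorm_sqr subr_gt0.
  apply: le_trans (normc_fr_op_le a _ (key f fL1 z z1)) _.
    by apply: measurable_kernelM => //; case: fL1.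
  rewrite le_eqVlt; apply/orP; left; apply/eqP; rewrite /C.
  by field; rewrite (gt_eqF ca0) (gt_eqF z0).
split=> //; split.
  by apply: measurable_fr_op => //; case: fL1.
by apply: le_lt_trans bd _; rewrite L1fin// -EFinM ltry.
Qed.

End operator.

(** * From boundedness to a pointwise bound on the kernel *)

Section necessity.
Variables (R : realType) (n : nat).
Implicit Types (z w t : n.-tuple R[i]) (a b c alpha : R) (f : n.-tuple R[i] -> R[i]).
Implicit Types (phi : n.-tuple R[i] -> n.-tuple R[i] -> R).
Local Notation Re := (@complex.Re R).
Local Notation Im := (@complex.Im R).
Local Notation normc := (@Normc.normc R).
Local Notation T := (n.-tuple R[i]).
Implicit Type k : T -> T -> R[i].

(** With $A = 1-|z|^2$, $B = 1-|w|^2$ and $r = |1-\langle z,w\rangle|$, one has $A, B \le 2r$ and $r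
    \le 3$. Each hypothesis makes one of the exponents $a$, $b-\alpha$, $a+b-\alpha-c$ nonnegative,
    so that the corresponding power is monotone. *)
Lemma phase_kernel_le a b c alpha phi : 0 <= a -> alpha <= b -> c <= a + b - alpha ->
  exists2 M, 0 <= M & forall z w, cball z -> cball w ->
    (1 - hnorm z ^+ 2) `^ a * normc (phase_kernel b c phi z w) <=
    M * (1 - hnorm w ^+ 2) `^ alpha.
Proof.
move=> a0 alphab hc; exists (2 `^ a * 2 `^ (b - alpha) * 3 `^ (a + b - alpha - c)).
  by rewrite !mulr_ge0 ?powR_ge0.
move=> z w z1 w1; rewrite normc_phase_kernel /kernel_mod.
have := rho_ge z w; have := rho_gt0 z1 w1; have := rho_le z1 w1.
rewrite cball_hnorm_sqr in z1; rewrite cball_hnorm_sqr in w1.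
move: (subr_gt0 (hnorm z ^+ 2) 1) (subr_gt0 (hnorm w ^+ 2) 1); rewrite z1 w1 => {z1 w1}.
move: (1 - hnorm z ^+ 2) (1 - hnorm w ^+ 2) (rho z w) => A B r A0 B0 r3 r0 ABr.
have hA : A `^ a <= (2 * r) `^ a by apply: ge0_ler_powR; rewrite ?nnegrE; lra.
have hB : B `^ (b - alpha) <= (2 * r) `^ (b - alpha).
  by apply: ge0_ler_powR; rewrite ?nnegrE; lra.
have hr : r `^ (a + b - alpha - c) <= 3 `^ (a + b - alpha - c).
  by apply: ge0_ler_powR; rewrite ?nnegrE; lra.
have eB : B `^ b = B `^ (b - alpha) * B `^ alpha.
  by rewrite -powRD ?subrK// (gt_eqF B0) implybT.
have er : r `^ (a + b - alpha - c) = r `^ a * r `^ (b - alpha) / r `^ c.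
  rewrite -powRN -!powRD ?(gt_eqF r0) ?implybT//; congr powR; ring.
have rc0 : r `^ c != 0 by rewrite gt_eqF ?powR_gt0.
rewrite eB (_ : _ * _ = A `^ a * B `^ (b - alpha) / r `^ c * B `^ alpha); last by field.
apply: ler_wpM2r; first exact: powR_ge0.
apply: (@le_trans _ _ ((2 * r) `^ a * (2 * r) `^ (b - alpha) / r `^ c)).
  apply: ler_wpM2r; first by rewrite invr_ge0 powR_ge0.
  by apply: ler_pM; rewrite ?powR_ge0.
rewrite !powRM ?(ltW r0)//.
rewrite (_ : _ / _ =
  2 `^ a * 2 `^ (b - alpha) * (r `^ a * r `^ (b - alpha) / r `^ c)); last by field.
by rewrite -er; apply: ler_wpM2l.
Qed.

(** A null set cannot contain a box of positive mass. This turns an essential bound into a bound at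
    some point as close to the centre as desired. *)
Lemma ae_box (P : set T) z d : 0 < d -> box z d `<=` @cball R n ->
  (\forall x \ae @nvol R n, P x) -> exists2 x, box z d x & P x.
Proof.
move=> d0 dB [N [mN N0 PN]]; apply: contrapT => nP.
have sN : box z d `<=` N.
  by move=> x zx; apply: PN => Px; apply: nP; exists x.
have := nvol_box_gt0 d0 dB; apply/negP; rewrite -leNgt -N0.
by apply: le_measure; rewrite ?inE//; exact: measurable_box.
Qed.

Definition cvg_kernel k z0 w0 :=
  (Re (k p.1 p.2) @[p --> filter_prod (near_box z0) (near_box w0)] --> Re (k z0 w0)) /\
  (Im (k p.1 p.2) @[p --> filter_prod (near_box z0) (near_box w0)] --> Im (k z0 w0)).

(* Local averaging: test the operator on [k(z0,w0)^-1] times the indicator of a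
   small box around [w0], and evaluate it close to [z0]. *)
Lemma bounded_L1_Linf_kernel_le a alpha k : -1 < alpha ->
  bounded_L1_Linf alpha a k ->
  exists M, forall z0 w0, cball z0 -> cball w0 -> cvg_kernel k z0 w0 ->
    k z0 w0 != 0 ->
    (1 - hnorm z0 ^+ 2) `^ a * normc (k z0 w0) <= M * (1 - hnorm w0 ^+ 2) `^ alpha.
Proof.
move=> alpha1 [kconv [C kC]].
have ca0 := c_alpha_gt0 n alpha1.
have mB := @measurable_cball R n.
(* The 8 collects three factors 2, lost on the weight near [z0], on the density near [w0] and on the
   real part of the normalized kernel. The absolute value covers a negative [C]. *)
exists (8 * `|C| * c_alpha n alpha) => z0 w0 z1 w1 [cr ci] k0.
set kap := k z0 w0 in k0 *.
have kap0 : 0 < normc kap.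
  rewrite lt_neqAle normc_ge0 andbT eq_sym; apply: contra k0 => /eqP.
  by move/Normc.eq0_normc/eqP.
have A0 : 0 < (1 - hnorm z0 ^+ 2) `^ a.
  by apply: powR_gt0; move: z1; rewrite cball_hnorm_sqr subr_gt0.
have B0 : 0 < (1 - hnorm w0 ^+ 2) `^ alpha.
  by apply: powR_gt0; move: w1; rewrite cball_hnorm_sqr subr_gt0.
have cpowR z (p : R) : cball z -> (1 - hnorm t ^+ 2) `^ p @[t --> near_box z] -->
    (1 - hnorm z ^+ 2) `^ p.
  move=> zB; apply: (cvg_comp (fun t => 1 - hnorm t ^+ 2) (@powR R ^~ p)).
    by apply: cvgB; [exact: cvg_cst|exact: cvg_near_box_hnorm_sqr].
  by apply: continuous_powR_gt0; move: zB; rewrite cball_hnorm_sqr subr_gt0.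
have nA : \forall z \near near_box z0,
    (1 - hnorm z0 ^+ 2) `^ a / 2 < (1 - hnorm z ^+ 2) `^ a.
  by apply: cvgr_gt (cpowR _ _ z1) _ _; rewrite ltr_pdivrMr// ltr_pMr// ltr1n.
have nB : \forall w \near near_box w0,
    (1 - hnorm w ^+ 2) `^ alpha < 2 * (1 - hnorm w0 ^+ 2) `^ alpha.
  by apply: cvgr_lt (cpowR _ _ w1) _ _; rewrite ltr_pMl// ltr1n.
(* After division by [kap] the kernel tends to 1, so its real part stays above 1/2 and no
   cancellation can occur in the integral over the box. *)
have nK : \forall p \near filter_prod (near_box z0) (near_box w0),
    1 / 2 < Re (k p.1 p.2 * kap^-1).
  have : Re (k p.1 p.2 * kap^-1) @[p --> filter_prod (near_box z0) (near_box w0)] -->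
      Re (kap * kap^-1).
    rewrite Re_mulc; under eq_fun do rewrite Re_mulc.
    by apply: cvgB; apply: cvgM => //; exact: cvg_cst.
  rewrite divff// => /cvgr_gt; apply => /=; lra.
case: nK => -[P Q] [/= nP nQ] PQ.
have [d1 d10 U1] : near_box z0 (P `&` (@cball R n `&`
    [set z | (1 - hnorm z0 ^+ 2) `^ a / 2 < (1 - hnorm z ^+ 2) `^ a])).
  by apply: filterI => //; apply: filterI => //; exact: near_box_cball.
have [d2 d20 V1] : near_box w0 (Q `&` (@cball R n `&`
    [set w | (1 - hnorm w ^+ 2) `^ alpha < 2 * (1 - hnorm w0 ^+ 2) `^ alpha])).
  by apply: filterI => //; apply: filterI => //; exact: near_box_cball.
set V := box w0 d2 in V1.
have mV : measurable V by exact: measurable_box.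
have VB : V `<=` @cball R n by move=> w /V1 [_ []].
have v0 : (0 < @nvol R n V)%E by exact: nvol_box_gt0.
have vfin : @nvol R n V \is a fin_num by exact: fin_num_measure.
set v := fine (@nvol R n V).
have vE : @nvol R n V = v%:E by rewrite fineK.
have {}v0 : 0 < v by move: v0; rewrite vE lte_fin.
pose f : T -> R[i] := (cst kap^-1) \_ V.
have fV w : V w -> f w = kap^-1 by move=> Vw; rewrite /f patchE mem_set.
have fNV w : ~ V w -> f w = 0 by move=> Vw; rewrite /f patchE memNset.
have mf : measurable_fun setT f by apply/(measurable_restrictT _ mV); exact: measurable_cst.
(* [L] bounds $|f|$ times the density of $v_\alpha$ on [V], so the norm of [f] is at most
   [L * v]. *)
pose L := (normc kap)^-1 * (c_alpha n alpha * (2 * (1 - hnorm w0 ^+ 2) `^ alpha)).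
have L0 : 0 <= L by rewrite /L mulr_ge0 ?invr_ge0 ?normc_ge0// mulr_ge0 ?(ltW ca0)// mulr_ge0// ltW.
have fL : (L1norm alpha f <= (L * v)%:E)%E.
  rewrite /L1norm.
  rewrite (eq_integral ((fun w => ((normc kap)^-1 *
     (c_alpha n alpha * (1 - hnorm w ^+ 2) `^ alpha))%:E) \_ V)); last first.
    move=> w _; rewrite patchE; case: ifPn => [/set_mem Vw|/negP Vw].
      by rewrite fV// Normc.normcV.
    by rewrite fNV ?Normc.normc0 ?mul0r// => /mem_set.
  rewrite -integral_mkcondr (setIidr VB).
  apply: (@le_trans _ _ (\int[@nvol R n]_(w in V) L%:E)%E).
    apply: ge0_le_integral => //.
    - by move=> w _; rewrite lee_fin mulr_ge0 ?invr_ge0 ?normc_ge0// mulr_ge0 ?powR_ge0 ?(ltW ca0).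
    - apply/measurable_EFinP; apply: measurable_funM => //; apply: measurable_funTS.
      apply: measurable_funM => //.
      apply: (measurableT_comp (measurable_powR alpha)); apply: measurable_funB => //.
      by apply: measurable_funX; exact: measurable_hnorm.
    - move=> w /V1 [_ [_ /= wlt]]; rewrite lee_fin.
      apply: ler_wpM2l; first by rewrite invr_ge0 normc_ge0.
      by apply: ler_wpM2l; [exact: ltW|exact: ltW].
  by rewrite integral_cst// (EFinM L v) -vE.
have fL1 : in_L1 alpha f.
  by split; [exact: measurable_funTS|apply: le_lt_trans fL _; exact: ltry].
have [_ fC] := kC f fL1.
have LE : L1norm alpha f = (fine (L1norm alpha f))%:E.
  rewrite fineK// ge0_fin_numE; first by case: fL1.
  apply: integral_ge0 => w _.
  by rewrite lee_fin mulr_ge0 ?normc_ge0// mulr_ge0 ?powR_ge0 ?(ltW ca0).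
rewrite LE -EFinM in fC; move/ess_supP : fC => fC.
have UB := subset_trans U1 (subset_trans (@subIsetr _ _ _) (@subIsetl _ _ _)).
(* The essential bound need not hold at [z0] itself; a nearby point [z] where it holds is used
   instead. *)
have [z Uz fz] := ae_box d10 UB fC.
have [Pz [zB zA]] := U1 z Uz; rewrite /= in zA.
rewrite lee_fin in fz.
have [mkf ikf] := kconv f fL1 z zB.
have iRe : (@nvol R n).-integrable (@cball R n) (EFin \o (fun w => Re (k z w * f w))).
  apply/integrableP; split.
    by apply/measurable_EFinP; apply: measurableT_comp mkf; exact: measurable_Re.
  apply: le_lt_trans ikf; apply: ge0_le_integral => //.
  - apply: measurableT_comp => //; apply/measurable_EFinP.
    by apply: measurableT_comp mkf; exact: measurable_Re.
  - by apply/measurable_EFinP; apply: measurableT_comp mkf; exact: measurable_normc.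
  - by move=> w _; rewrite /= lee_fin normc_Re_le.
(* The integrand vanishes off [V] and has real part above 1/2 on it. *)
have lowRe : v / 2 <= Re (cintegral (@cball R n) (fun w => k z w * f w)).
  rewrite /cintegral /=.
  rewrite (_ : \int[_]_(w in _) _ = \int[@nvol R n]_(w in V) Re (k z w * f w)); last first.
    rewrite -[in RHS](setIidr VB) Rintegral_mkcondr; apply: eq_Rintegral => w _.
    rewrite patchE; case: ifPn => // /negP Vw.
    by rewrite fNV ?mulr0// => /mem_set.
  rewrite (_ : v / 2 = \int[@nvol R n]_(w in V) (1 / 2 : R)); last first.
    by rewrite Rintegral_cst// -/v; ring.
  apply: le_Rintegral => //.
  - exact: finite_measure_integrable_cst.
  - exact: integrableS iRe.
  - move=> w Vw; rewrite fV//; apply/ltW/(PQ (z, w)); split => //=.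
    by have [] := V1 w Vw.
have {}fz : ((1 - hnorm z0 ^+ 2) `^ a / 2) * (v / 2) <= `|C| * (L * v).
  apply: (@le_trans _ _ (C * fine (L1norm alpha f))).
    apply: le_trans fz; rewrite /fr_op Normc.normcM.
    rewrite (_ : normc ((1 - hnorm z ^+ 2) `^ a)%:C%C = (1 - hnorm z ^+ 2) `^ a); last first.
      by rewrite /= expr0n/= addr0 sqrtr_sqr ger0_norm ?powR_ge0.
    apply: ler_pM (ltW (divr_gt0 A0 _)) (ltW (divr_gt0 v0 _)) (ltW zA) _ => //.
    apply: le_trans lowRe _; apply: le_trans (ler_norm _) _; exact: normc_Re_le.
  apply: (@le_trans _ _ (`|C| * fine (L1norm alpha f))).
    apply: ler_wpM2r; last exact: ler_norm.
    by rewrite fine_ge0// LE lee_fin fine_ge0// integral_ge0// => w _;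
      rewrite lee_fin mulr_ge0 ?normc_ge0// mulr_ge0 ?powR_ge0 ?(ltW ca0).
  by apply: ler_wpM2l => //; rewrite -lee_fin -LE.
(* The factor [v] occurs on both sides and cancels, so the resulting bound does not depend on the
   size of the box. *)
have := fz; rewrite -(ler_pM2r (_ : 0 < 4 * normc kap / v)); last first.
  by rewrite divr_gt0// mulr_gt0.
rewrite /L; congr (_ <= _).
  by field; rewrite gt_eqF.
by field; rewrite !gt_eqF.
Qed.

End necessity.

(** * Test points on the first axis and the inequalities on the exponents *)

Section points.
Variables (R : realType) (n : nat).
Local Notation Re := (@complex.Re R).
Local Notation Im := (@complex.Im R).

Lemma powR_bounded_ge0 (p M : R) :
  (forall t, 0 < t <= 1 -> t `^ p <= M) -> 0 <= p.
Proof.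
move=> h; rewrite leNgt; apply/negP => p0.
have M0 : 0 <= M by apply: le_trans (h 1 _); rewrite ?powR_ge0// ltr01 lexx.
(* For $p < 0$ the point $t = e^{M/p}$ lies in $]0,1]$ and $t^p = e^M \ge 1 + M$, which contradicts
   the bound. *)
have := h (expR (M / p)); rewrite expR_gt0 -expR0 ler_expR.
rewrite mulr_ge0_le0 ?invr_le0 ?(ltW p0)// => /(_ isT).
rewrite /powR gt_eqF ?expR_gt0// expRK mulrC divfK ?lt_eqF//.
by have := expR_ge1Dx M; lra.
Qed.

(** This is the point $r e_1$. *)
Definition axis_point (r : R) : n.-tuple R[i] :=
  [tuple (if val i == 0%N then r%:C%C else 0) | i < n].

Hypothesis n_gt0 : (0 < n)%N.

Lemma sum_axis (F : R -> R) : F 0 = 0 -> forall r,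
  \sum_(i < n) F (if val i == 0%N then r else 0) = F r.
Proof.
move=> F0 r; rewrite (bigD1 (Ordinal n_gt0))//= big1 ?addr0// => i i0.
by rewrite ifN// F0.
Qed.

Lemma hnorm_axis_point r : hnorm (axis_point r) ^+ 2 = r ^+ 2.
Proof.
rewrite hnorm_sqr -[RHS](sum_axis (F := fun x => x ^+ 2)) ?expr0n//.
apply: eq_bigr => i _; rewrite tnth_mktuple.
by case: ifP => _ /=; rewrite expr0n addr0.
Qed.

Lemma hdot_axis_point r s : hdot (axis_point r) (axis_point s) = (r * s)%:C%C.
Proof.
rewrite /hdot (bigD1 (Ordinal n_gt0))//= big1 => [|i i0]; last first.
  by rewrite !tnth_mktuple ifN// mul0r.
rewrite addr0 !tnth_mktuple/=.
by apply/eqP; rewrite eq_complex /= oppr0 !mulr0 !mul0r subr0 addr0 !eqxx.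
Qed.

Lemma rho_axis_point r s : r * s <= 1 -> rho (axis_point r) (axis_point s) = 1 - r * s.
Proof.
move=> rs; rewrite /rho hdot_axis_point /= oppr0 addr0 expr0n/= addr0.
by rewrite sqrtr_sqr ger0_norm// subr_ge0.
Qed.

Lemma cball_axis_point r : r ^+ 2 < 1 -> cball (axis_point r).
Proof. by rewrite cball_hnorm_sqr hnorm_axis_point. Qed.

(** When one of the points is 0, $\langle z,w\rangle = 0$ and the denominator is 1, which isolates
    $a$ or $b-\alpha$. On the diagonal, $1-|z|^2$, $1-|w|^2$ and $1-\langle z,w\rangle$ all equal
    $t$, which combines all the exponents. *)
Lemma kernel_mod_bound_exponents a b c alpha (M : R) :
  (forall z w, @cball R n z -> @cball R n w ->
    (1 - hnorm z ^+ 2) `^ a * kernel_mod b c z w <= M * (1 - hnorm w ^+ 2) `^ alpha) ->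
  [/\ 0 <= a, alpha <= b & c <= a + b - alpha].
Proof.
move=> h.
(* The choice $r = \sqrt{1-t}$ makes $1 - r^2 = t$; positivity of $t$ keeps the point inside the
   ball. *)
have pt t : 0 < t <= 1 -> exists2 r : R, r ^+ 2 = 1 - t & r ^+ 2 < 1.
  by move=> /andP[t0 t1]; exists (Num.sqrt (1 - t)); rewrite sqr_sqrtr; lra.
have z1 : (0 : R) ^+ 2 < 1 by rewrite expr0n/=.
have B0 := cball_axis_point z1.
split.
- apply: (@powR_bounded_ge0 _ M) => t /[dup] /andP[t0 _] /pt[r rt r1].
  have := h _ _ (cball_axis_point r1) B0.
  rewrite /kernel_mod rho_axis_point ?mulr0// !hnorm_axis_point expr0n/= subr0 !powR1.
  by rewrite divr1 !mulr1 rt subKr.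
- rewrite -subr_ge0; apply: (@powR_bounded_ge0 _ M) => t /[dup] /andP[t0 _] /pt[r rt r1].
  have := h _ _ B0 (cball_axis_point r1).
  rewrite /kernel_mod rho_axis_point ?mul0r// !hnorm_axis_point expr0n/= subr0 !powR1.
  rewrite divr1 mul1r rt subKr powRB ?(gt_eqF t0) ?implybT//.
  by rewrite ler_pdivrMr ?powR_gt0.
(* The exponent is grouped so that expanding the power gives the factors $t^a$, $t^b$, $t^{-c}$,
   $t^{-\alpha}$ in the order of the kernel bound. *)
- suff : 0 <= a + (b + (- c - alpha)) by lra.
  apply: (@powR_bounded_ge0 _ M) => t /[dup] /andP[t0 _] /pt[r rt r1].
  have := h _ _ (cball_axis_point r1) (cball_axis_point r1).
  have rr : r * r <= 1 by rewrite -expr2 ltW.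
  rewrite /kernel_mod rho_axis_point// -expr2 !hnorm_axis_point rt subKr.
  rewrite !powRD ?(gt_eqF t0) ?implybT// !powRN.
  by rewrite -ler_pdivrMr ?powR_gt0// !mulrA.
Qed.

End points.

(** * The boundedness criterion for kernels with a continuous phase *)

Section phase_kernel_bounded.
Variables (R : realType) (n : nat) (n_gt0 : (0 < n)%N) (a b c alpha : R).
Variable phi : n.-tuple R[i] -> n.-tuple R[i] -> R.
Hypothesis alpha_gtN1 : -1 < alpha.
Hypothesis mphi : measurable_fun setT
  (fun p : n.-tuple R[i] * n.-tuple R[i] => phi p.1 p.2).
Hypothesis cphi : forall z w, cball z -> cball w ->
  phi p.1 p.2 @[p --> filter_prod (near_box z) (near_box w)] --> phi z w.

(** The pointwise condition sees the modulus only. Measurability of the phase enters in the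
    sufficiency, its continuity in the necessity. *)
Lemma bounded_phase_kernelP :
  bounded_L1_Linf alpha a (phase_kernel b c phi) <->
  [/\ 0 <= a, alpha <= b & c <= a + b - alpha].
Proof.
split=> [bd|[a0 ab cab]].
  have [M hM] := bounded_L1_Linf_kernel_le alpha_gtN1 bd.
  apply: (@kernel_mod_bound_exponents _ _ n_gt0 _ _ _ _ M) => z w z1 w1.
  rewrite -(normc_phase_kernel _ _ phi); apply: hM => //.
    exact: cvg_phase_kernel (cphi z1 w1).
  (* The modulus is a quotient of positive powers on the ball, so the kernel has no zero there and
     the local test applies at every pair. *)
  apply/eqP => k0; have := normc_phase_kernel b c phi z w.
  rewrite k0 Normc.normc0; apply/eqP; rewrite lt_eqF//.
  rewrite /kernel_mod divr_gt0 ?powR_gt0 ?rho_gt0//.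
  by move: w1; rewrite cball_hnorm_sqr subr_gt0.
have [M M0 hM] := phase_kernel_le phi a0 ab cab.
apply: (bounded_L1_Linf_kernel alpha_gtN1 M0) hM.
exact: measurable_phase_kernel.
Qed.

End phase_kernel_bounded.

Theorem theorem1p2 (R : realType) (n : nat) (hn : (1 <= n)%N)
    (a b c alpha : R) (halpha : -1 < alpha) :
  (bounded_L1_Linf alpha a (S_kernel n b c) <->
   bounded_L1_Linf alpha a (T_kernel n b c)) /\
  (bounded_L1_Linf alpha a (T_kernel n b c) <->
   [/\ 0 <= a, alpha <= b & c <= a + b - alpha]).
Proof.
have TP : bounded_L1_Linf alpha a (T_kernel n b c) <->
    [/\ 0 <= a, alpha <= b & c <= a + b - alpha].
  rewrite T_kernelE; apply: bounded_phase_kernelP => //.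
    exact: measurable_phase.
  by move=> z w z1 w1; exact: cvg_phase.
have SP : bounded_L1_Linf alpha a (S_kernel n b c) <->
    [/\ 0 <= a, alpha <= b & c <= a + b - alpha].
  rewrite S_kernelE; apply: bounded_phase_kernelP => //.
  by move=> z w _ _; exact: cvg_cst.
by split; [exact: iff_trans SP (iff_sym TP)|exact: TP].
Qed.
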